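(* For every $n\geq 2$, $\mathrm{p}(A,C_n)\geq |\phi_2(n)|$, where $\phi_2(n)=\{k\mid 0\leq k\leq n-1,\ \gcd(k,n)=2^w \text{ for some } w\geq 0\}$. Equivalently, $\operatorname{GKdim}\big((A\#C_n)/(e_0)\big)\leq n-|\phi_2(n)|$.
   Context: $\Bbbk$ is an algebraically closed field of characteristic zero and $n\ge 2$. $A=\Bbbk_{-1}[x_0,\dots,x_{n-1}]$ is generated by degree-one $x_0,\dots,x_{n-1}$ with $x_ix_j=-x_jx_i$ ($i\neq j$); $C_n=\langle\sigma\rangle$ acts by $\sigma(x_i)=x_{i+1}$ (indices in $\mathbb{Z}_n$). $A\#C_n$ is the skew group algebra, $e_0=1\#\frac1n\sum_{g\in C_n}g$, $(e_0)$ the two-sided ideal it generates, and $\mathrm{p}(A,C_n)=\operatorname{GKdim}A-\operatorname{GKdim}\big((A\#C_n)/(e_0)\big)$. Here $\gcd(0,n)=n$. *)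

(* Defs.v *)
From HB Require Import structures.
From mathcomp Require Import all_boot all_order all_algebra.
Set Implicit Arguments. Unset Strict Implicit. Unset Printing Implicit Defensive.
Import Order.TTheory GRing.Theory Num.Theory.
Local Open Scope ring_scope.

(* Concrete model of A = k_{-1}[x_0..x_{n-1}] and of A # C_n.
   Variables x_i are indexed by i : 'Z_n (n >= 2 in the theorem), ordered by
   their value; C_n = <sigma> is identified with 'Z_n (sigma^g), and
   sigma^g (x_i) = x_{i+g}.  A has the k-basis of ordered monomials
   x^a = x_0^{a_0} ... x_{n-1}^{a_{n-1}}; a word w in the variables equals
   (-1)^{#strict inversions of w} times the ordered monomial with the same
   exponents (this is exactly what the relations x_i x_j = - x_j x_i give). *)

Section Model.
Variable F : fieldType.
Variable n : nat.

Definition Mon (d : nat) := {ffun 'Z_n -> 'I_d.+1}.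

Definition deg d (a : Mon d) : nat := (\sum_(i : 'Z_n) (a i : nat))%N.

Definition word_of d (a : Mon d) : seq 'Z_n :=
  flatten [seq nseq (a i) i | i <- enum 'Z_n].

Definition inversions (w : seq 'Z_n) : nat :=
  (\sum_(i < size w) \sum_(j < size w | (i < j)%N)
      (nat_of_ord (nth (0%R : 'Z_n) w j) < nat_of_ord (nth (0%R : 'Z_n) w i))%N)%N.

Definition wsign (w : seq 'Z_n) : F := (-1) ^+ inversions w.

(* exponent vector of a word (of length <= d) *)
Definition mon_of d (w : seq 'Z_n) : Mon d := [ffun i => inord (count_mem i w)].

(* degree-d part of A # C_n : coordinates indexed by (monomial, group element);
   only the coordinates with deg a = d are ever used. *)
Definition Sp d := {ffun (Mon d * 'Z_n) -> F^o}.

Definition basis_vec d (p : Mon d * 'Z_n) : Sp d :=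
  [ffun q => if q == p then 1 else 0].

(* (x^a # sigma^g) e_0 (x^b # sigma^h)
     = 1/n sum_f  x^a sigma^(g+f)(x^b) # sigma^(g+f+h),
   for deg a + deg b = d; this is the degree-d component. *)
Definition gen_vec d (u : (Mon d * 'Z_n) * (Mon d * 'Z_n)) : Sp d :=
  let: ((a, g), (b, h)) := u in
  if (deg a + deg b == d)%N then
    (n%:R)^-1 *: \sum_(f : 'Z_n)
       let w := word_of a ++ map (fun i => i + (g + f)) (word_of b) in
       wsign w *: basis_vec (mon_of d w, g + f + h)
  else 0.

Definition ideal_e0 d : {vspace Sp d} :=
  <<[seq gen_vec u | u : ((Mon d * 'Z_n) * (Mon d * 'Z_n))%type]>>%VS.

Definition dim_quot d : nat :=
  (#|[set a : Mon d | deg a == d]| * #|'Z_n| - \dim (ideal_e0 d))%N.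

(* dim of V^d, with V = degree <= 1 part (a generating frame containing 1) *)
Definition hilb_quot d : nat := (\sum_(i < d.+1) dim_quot i)%N.

End Model.

(* GKdim bound: for a frame-growth function H, "limsup_d log H(d)/log d <= m"
   (the definition of GKdim <= m), written with rational epsilon = 1/k:
   for every k >= 1, eventually H(d) <= d^(m + 1/k), i.e. H(d)^k <= d^(m k + 1). *)
Definition GKdim_le (H : nat -> nat) (m : nat) : Prop :=
  forall k : nat, (0 < k)%N ->
    exists D : nat, forall d : nat, (D <= d)%N -> (H d ^ k <= d ^ (m * k + 1))%N.

(* phi_2(n) = { k | 0 <= k <= n-1, gcd(k,n) = 2^w for some w }  (gcd(0,n) = n);
   since gcd(k,n) <= n < 2^(n+1), bounding w by n is harmless. *)
Definition phi2 (n : nat) : {set 'I_n} :=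
  [set k : 'I_n | [exists w : 'I_n.+1, (gcdn k n == 2 ^ w)%N]].

Lemma in_phi2 n (k : 'I_n) :
  (k \in phi2 n) <-> exists w : nat, gcdn k n = (2 ^ w)%N.
Proof.
rewrite inE; split.
  by case/existsP=> w /eqP ->; exists w.
case=> w Hw; apply/existsP.
have Hn : (0 < n)%N := leq_ltn_trans (leq0n k) (ltn_ord k).
have Hwn : (w < n.+1)%N.
  have : (2 ^ w <= n)%N by rewrite -Hw dvdn_leq // dvdn_gcdr.
  move=> H; exact: leq_trans (leq_trans (ltn_expl w (isT : (1 < 2)%N)) H) (leqnSn n).
by exists (Ordinal Hwn); rewrite Hw.
Qed.

(* Main.v *)
Require Import Defs.
From HB Require Import structures.
From mathcomp Require Import all_boot all_order all_algebra all_field.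
From mathcomp Require Import cyclic zify.
Import GRing.Theory.
Local Open Scope ring_scope.
Set Implicit Arguments. Unset Strict Implicit. Unset Printing Implicit Defensive.

(** Let [z] be a primitive [n]-th root of unity, [b_g = sum_i z^(gi) x_i] and
    [c_j = sum_i z^(ji) x_i^2]. The [c_j] are central, [b_g b_h + b_h b_g = 2 c_(g+h)],
    and [b_g] shifts the isotypic components ("states") of the [C_n]-action by [g].
    Modulo [(e_0)] the component of state [0] vanishes, so [c_j] is nilpotent from
    state [s] as soon as it is from [s + g] and from [s + j - g], for any one [g],
    because [2 c_j = b_(j-g) b_g + b_g b_(j-g)].
    If [j = 2h] with [gcd(h,n) = 2^w], taking [g = h] reaches all multiples of [h],
    and [g = s + h] reduces [s] to [2s + h] and [h], hence eventually to [2^w s]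
    plus a multiple of [h], which is a multiple of [h]. If [j] is a unit, [c_(2j)] is
    nilpotent and modulo it [2 c_j] acts on the kernel of [b_j] as [b_j b_0], which
    walks through all states. So [c_j] is nilpotent for every [j] in [phi_2(n)], while
    the quotient is a finitely generated module over [k[c_0, ..., c_(n-1)]]. *)

(* [U s v]: the vector [v] lies in state [s]; [K] is the submodule to be reached. *)
Record walk_module (F : fieldType) n (V : vectType F) (b c : 'Z_n -> 'End(V))
    (U : 'Z_n -> V -> Prop) (K : V -> Prop) : Prop := WalkModule {
  wm_anticomm : forall g h v, b g (b h v) + b h (b g v) = c (g + h) v *+ 2;
  wm_sqr : forall g v, b g (b g v) = c (g + g) v;
  wm_central : forall j g v, c j (b g v) = b g (c j v);
  wm_step : forall s g v, U s v -> U (s + g) (b g v);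
  wm_stepc : forall s j v, U s v -> U (s + j) (c j v);
  wm_zero : forall v, U 0 v -> K v;
  wm_add : forall u v, K u -> K v -> K (u + v);
  wm_stable : forall g v, K v -> K (b g v);
  wm_half : forall v, K (v *+ 2) -> K v }.

Lemma iterfD (V : zmodType) (f : {additive V -> V}) M :
  {morph iter M f : u v / u + v}.
Proof. by move=> u v; elim: M => //= M ->; rewrite raddfD. Qed.

(** * Stability of [K] under the central operators and their powers *)

Section WalkModule.
Variables (F : fieldType) (n : nat) (V : vectType F).
Variables (b c : 'Z_n -> 'End(V)) (U : 'Z_n -> V -> Prop) (K : V -> Prop).
Hypothesis W : walk_module b c U K.

Lemma walk_stable_central j v : K v -> K (c j v).
Proof.
move=> Kv; apply: (wm_half W); rewrite -[j]addr0 -(wm_anticomm W).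
by apply: (wm_add W); do 2!apply: (wm_stable W).
Qed.

Lemma walk_stable_iter j M v : K v -> K (iter M (c j) v).
Proof. by move=> Kv; elim: M => //= M; apply: walk_stable_central. Qed.

Lemma walk_iter_leq j M N v :
  (M <= N)%N -> K (iter M (c j) v) -> K (iter N (c j) v).
Proof. by move=> leMN; rewrite -(subnK leMN) iterD; apply: walk_stable_iter. Qed.

Lemma iter_central j g M v : iter M (c j) (b g v) = b g (iter M (c j) v).
Proof. by elim: M => //= M ->; rewrite (wm_central W). Qed.

Lemma iter_anticomm j g M v :
  iter M.+1 (c j) v *+ 2 =
  b (j - g) (iter M (c j) (b g v)) + b g (iter M (c j) (b (j - g) v)).
Proof.
by rewrite -!iter_central -iterfD (wm_anticomm W) subrK iterSr !mulr2n iterfD.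
Qed.

(* On vectors killed by [b j] modulo [K], [2 c j] acts as [b j b 0], which
   moves the state by [j]. *)
Lemma walk_killed_by_step j k v :
  U (- (j *+ k)) v -> K (b j v) -> K (iter k (c j) v).
Proof.
elim: k v => [|k IH] v Uv Kv; first by apply: (wm_zero W); rewrite -oppr0.
apply: (wm_half W); rewrite (iter_anticomm _ 0) subr0; apply: (wm_add W).
  rewrite -iter_central; apply: IH.
    have -> : - (j *+ k) = - (j *+ k.+1) + 0 + j.
      by rewrite addr0 mulrSr opprD subrK.
    by do 2!apply: (wm_step W).
  (* The new vector is again killed by [b j] modulo [K]: the square of [b j] is [c (j + j)], which
     commutes with [b 0]. *)
  rewrite (wm_sqr W) (wm_central W) -(wm_sqr W).
  by do 2!apply: (wm_stable W).
by rewrite -iter_central; apply: walk_stable_iter; apply: (wm_stable W).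
Qed.

End WalkModule.

(** The exponent is chosen before the module, so that one exponent serves the truncations for all
    [d]. *)
Definition nilpotent_from (F : fieldType) n (j s : 'Z_n) : Prop :=
  exists M, forall (V : vectType F) (b c : 'Z_n -> 'End(V)) U K,
    walk_module b c U K -> forall v, U s v -> K (iter M (c j) v).

(** * Nilpotency of [c j] when [gcdn j n] is a power of two *)

Section Nilpotency.
Variables (F : fieldType) (n : nat).
Implicit Types j s g h : 'Z_n.
Local Notation nilpotent_from := (@nilpotent_from F n).

Lemma nilpotent_from_back j s g :
  nilpotent_from j (s + g) -> nilpotent_from j (s + (j - g)) ->
  nilpotent_from j s.
Proof.
move=> [M1 Z1] [M2 Z2]; exists (maxn M1 M2).+1 => V b c U K W v Uv.
apply: (wm_half W); rewrite (iter_anticomm W _ g).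
apply: (wm_add W); apply: (wm_stable W).
  apply: (walk_iter_leq W (leq_maxl M1 M2)).
  by apply: (Z1 _ _ _ _ _ W); apply: (wm_step W).
apply: (walk_iter_leq W (leq_maxr M1 M2)).
by apply: (Z2 _ _ _ _ _ W); apply: (wm_step W).
Qed.

(** For [g = h] the two successor states coincide and lie one step [h] nearer to [0]. *)
Lemma nilpotent_from_multiple h k : nilpotent_from (h + h) (- (h *+ k)).
Proof.
elim: k => [|k IH].
  by exists 0 => V b c U K W v; rewrite mulr0n oppr0; apply: (wm_zero W).
apply: (@nilpotent_from_back _ _ h).
  by rewrite mulrS opprD addrAC addNr add0r.
by rewrite addrK mulrS opprD addrAC addNr add0r.
Qed.

(** For [g = s + h] the successors of [s] are [2s + h] and [h]; the map [s -> 2s + h] iterated [w]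
    times gives the state in the first hypothesis. *)
Lemma nilpotent_from_doubling h s w :
  nilpotent_from (h + h) (s *+ 2 ^ w + h *+ (2 ^ w).-1) ->
  nilpotent_from (h + h) h -> nilpotent_from (h + h) s.
Proof.
elim: w s => [|w IH] s; first by rewrite addr0.
move=> Z Zh; apply: (@nilpotent_from_back _ _ (s + h)).
  apply: IH => //; rewrite addrA -mulr2n mulrnDl -mulrnA -addrA -mulrnDr.
  rewrite -expnS (_ : 2 ^ w + (2 ^ w).-1 = (2 ^ w.+1).-1)%N //.
  by rewrite expnS; have := expn_gt0 2 w; lia.
by rewrite [s + h]addrC opprD !addrA addrK addrAC subrr add0r.
Qed.

Hypothesis n_gt1 : (1 < n)%N.

Lemma Zp_mulrn_char h : h *+ n = 0.
Proof. by rewrite -mulr_natr pchar_Zp ?mulr0. Qed.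

Lemma Zp_mulrn_opp h k : h *+ k = - (h *+ (n.-1 * k)).
Proof.
have /eqP : h *+ (n.-1 * k) + h *+ k = 0.
  by rewrite -mulrnDr -mulSnr (ltn_predK n_gt1) mulrnA Zp_mulrn_char mul0rn.
by rewrite addr_eq0 => /eqP->; rewrite opprK.
Qed.

(** Bezout: modulo [n], the gcd is a multiple of [h]. The sign is the one used by
    [nilpotent_from_multiple]. *)
Lemma Zp_mulrn_gcd h s : exists k, s *+ gcdn h n = - (h *+ k).
Proof.
have [k _ Dk] := Bezoutr h (ltnW n_gt1).
have Dg : (gcdn h n)%:R = - (h * k%:R) :> 'Z_n.
  apply/eqP; rewrite -addr_eq0 -[in X in _ + X](natr_Zp h) -natrM -natrD mulnC.
  by case/dvdnP: Dk => q ->; rewrite natrM pchar_Zp ?mulr0.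
exists (k * s)%N; rewrite -mulr_natr Dg mulrN -[in LHS](natr_Zp s) mulrC.
by rewrite -mulrA -natrM mulr_natr.
Qed.

Definition nilpotent j : Prop :=
  exists M, forall (V : vectType F) (b c : 'Z_n -> 'End(V)) U K,
    walk_module b c U K -> forall s v, U s v -> K (iter M (c j) v).

Lemma nilpotent_from_all j : (forall s, nilpotent_from j s) -> nilpotent j.
Proof.
move=> Zj; have [M ZM] := fin_all_exists Zj.
exists (\max_s M s) => V b c U K W s v Uv.
by apply: (walk_iter_leq W (leq_bigmax s)); apply: ZM W _ _.
Qed.

Lemma nilpotent_double h w : gcdn h n = (2 ^ w)%N -> nilpotent (h + h).
Proof.
move=> Dg; apply: nilpotent_from_all => s.
apply: (@nilpotent_from_doubling _ _ w).
  have [k] := Zp_mulrn_gcd h s; rewrite Dg => ->.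
  rewrite (Zp_mulrn_opp h (2 ^ w).-1) -opprD -mulrnDr.
  by apply: nilpotent_from_multiple.
rewrite -[in X in nilpotent_from _ X](mulr1n h) Zp_mulrn_opp.
exact: nilpotent_from_multiple.
Qed.

(** [c (j + j)] is nilpotent by [nilpotent_double] with exponent 0. On vectors that it kills modulo
    [K], [walk_killed_by_step] applies from any state, since every state is a multiple of the unit
    [j]. *)
Lemma nilpotent_coprime j : coprime j n -> nilpotent j.
Proof.
move=> co_jn; have [N ZN] := @nilpotent_double j 0 (eqP co_jn).
pose S s := exists M, forall (V : vectType F) (b c : 'Z_n -> 'End(V)) U K,
  walk_module b c U K -> forall v, U s v -> K (c (j + j) v) -> K (iter M (c j) v).
have S_all s : S s.
  have [k Dk] : exists k, s = - (j *+ k).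
    by have [k] := Zp_mulrn_gcd j s; rewrite (eqP co_jn) mulr1n; exists k.
  have [l Dl] : exists l, s + j = - (j *+ l).
    by have [l] := Zp_mulrn_gcd j (s + j); rewrite (eqP co_jn) mulr1n; exists l.
  exists (maxn k l).+1 => V b c U K W v Uv Kv; apply: (wm_half W).
  (* Both terms reduce to images under [b j] in state [s + j]. Such images are killed by [b j]
     modulo [K], because the square of [b j] is [c (j + j)]. *)
  rewrite (iter_anticomm W _ 0) subr0; apply: (wm_add W).
    rewrite -(iter_central W); apply: (walk_iter_leq W (leq_maxr k l)).
    apply: (walk_killed_by_step W).
      by rewrite -Dl -[s]addr0; do 2!apply: (wm_step W).
    by rewrite (wm_sqr W) (wm_central W); apply: (wm_stable W).
  apply: (wm_stable W); apply: (walk_iter_leq W (leq_maxr k l)).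
  apply: (walk_killed_by_step W); first by rewrite -Dl; apply: (wm_step W).
  by rewrite (wm_sqr W).
have [M SM] := fin_all_exists S_all; pose L := (\max_s M s)%N.
exists (N * L)%N => V b c U K W s v Uv.
have {}SM t u : U t u -> K (c (j + j) u) -> K (iter L (c j) u).
  by move=> Uu Ku; apply: (walk_iter_leq W (leq_bigmax t)); apply: (SM _ _ _ _ _ _ W).
have sqrC k u : c (j + j) (iter k (c j) u) = iter k (c j) (c (j + j) u).
  by rewrite -!(wm_sqr W) !(iter_central W).
have Uc g k t u : U t u -> exists t', U t' (iter k (c g) u).
  move=> Uu; elim: k => [|k [t' Ut']] /=; first by exists t.
  by exists (t' + g); apply: (wm_stepc W).
have: K (iter N (c (j + j)) v) by apply: (ZN _ _ _ _ _ W) Uv.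
(* Each of the [N] factors [c (j + j)] is traded for [L] factors [c j]. *)
elim: N s v Uv {ZN} => [|N IH] s v Uv //=.
have [t Ut] := Uc (j + j) N _ _ Uv; move/(SM _ _ Ut).
have -> k : iter L (c j) (iter k (c (j + j)) v) = iter k (c (j + j)) (iter L (c j) v).
  by elim: k => //= k <-; rewrite sqrC.
have [t' Ut'] := Uc j L _ _ Uv.
by move/(IH _ _ Ut'); rewrite mulSnr iterD.
Qed.

(** If the gcd is not 1, the representative of [j] is even. Its half [h] has [gcdn h n] dividing
    [gcdn j n], so this is again a power of two and [nilpotent_double] applies. *)
Lemma nilpotent_gcd_pow2 j w : gcdn j n = (2 ^ w)%N -> nilpotent j.
Proof.
case: w => [|w] Dj; first by apply: nilpotent_coprime; apply/eqP.
have even_j : ~~ odd j.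
  rewrite -dvdn2; apply: dvdn_trans (dvdn_gcdl j n).
  by rewrite Dj expnS dvdn_mulr.
pose h : 'Z_n := (j./2)%:R.
have Dh : h = j./2 :> nat.
  rewrite val_Zp_nat // modn_small //.
  by have := ltn_ord j; rewrite [X in (_ < X)%N]Zp_cast //; lia.
have -> : j = h + h.
  by rewrite -natrD addnn -[LHS]natr_Zp -[in LHS](even_halfK even_j).
have : (gcdn h n %| 2 ^ w.+1)%N.
  rewrite -Dj dvdn_gcd dvdn_gcdr andbT (dvdn_trans (dvdn_gcdl _ _)) //.
  by rewrite -[X in (_ %| X)%N](even_halfK even_j) Dh -muln2 dvdn_mulr.
by case/(dvdn_pfactor _ _ (isT : prime 2))=> v _; apply: nilpotent_double.
Qed.

Lemma nilpotent_uniform :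
  exists M, forall (V : vectType F) (b c : 'Z_n -> 'End(V)) U K,
    walk_module b c U K -> forall j, (exists w, gcdn j n = (2 ^ w)%N) ->
    forall s v, U s v -> K (iter M (c j) v).
Proof.
have /fin_all_exists[M ZM] : forall j, exists M,
    forall (V : vectType F) (b c : 'Z_n -> 'End(V)) U K,
    walk_module b c U K -> (exists w, gcdn j n = (2 ^ w)%N) ->
    forall s v, U s v -> K (iter M (c j) v).
  move=> j; have [/existsP[w /eqP/nilpotent_gcd_pow2[M ZM]]|no_w] :=
    boolP [exists w : 'I_n.+1, gcdn j n == 2 ^ w]%N.
    by exists M => V b c U K W _; apply: (ZM _ _ _ _ _ W).
  (* Here the gcd is no power of two, so [0] is a dummy value; the bound [w <= n] excludes no
     exponent. *)
  exists 0 => V b c U K W [w Dw]; case/existsP: no_w.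
  have lt_wn : (w < n.+1)%N.
    apply: leq_trans (ltn_expl w (isT : 1 < 2)%N) _; rewrite -Dw.
    by apply/leqW/dvdn_leq; rewrite ?dvdn_gcdr // ltnW.
  by exists (Ordinal lt_wn); rewrite Dw.
exists (\max_j M j)%N => V b c U K W j Pj s v Uv.
by apply: (walk_iter_leq W (leq_bigmax j)); apply: (ZM _ _ _ _ _ _ W) Uv.
Qed.

End Nilpotency.

(** * Signs and exponent vectors of words *)

Section Words.
Variables (F : fieldType) (n : nat).
Implicit Types (i k : 'Z_n) (u w z : seq 'Z_n).

Definition below i k := (k < i)%N.

Lemma inversions_cons i w : inversions (i :: w) = (count (below i) w + inversions w)%N.
Proof.
rewrite /inversions /= big_ord_recl /=; congr (_ + _)%N.
  rewrite big_mkcond big_ord_recl /= add0n -big_mkcond /=.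
  by rewrite -sum1_count (big_nth 0) big_mkord.
by apply: eq_bigr => l _; rewrite big_mkcond big_ord_recl /= add0n -big_mkcond.
Qed.

Lemma inversions_cat u w :
  inversions (u ++ w) =
  (inversions u + inversions w + \sum_(i <- u) count (below i) w)%N.
Proof.
elim: u => [|i u IH] /=; first by rewrite big_nil /inversions !big_ord0 addn0.
by rewrite !inversions_cons IH count_cat big_cons; lia.
Qed.

Lemma wsign_cat u w :
  wsign F (u ++ w) = wsign F u * wsign F w * (-1) ^+ (\sum_(i <- u) count (below i) w).
Proof. by rewrite /wsign inversions_cat !exprD. Qed.

Lemma wsign_sqr w : wsign F w * wsign F w = 1.
Proof. by rewrite -expr2 sqrr_sign. Qed.

(** The inversions between the prefix and [w] depend only on the letters of the prefix, so they
    cancel in the product. *)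
Lemma wsign_cat_perm u1 u2 w : perm_eq u1 u2 ->
  wsign F (u1 ++ w) * wsign F (u2 ++ w) = wsign F u1 * wsign F u2.
Proof.
move=> eq_u; rewrite !wsign_cat (perm_big _ eq_u) /= mulrACA -expr2 sqrr_sign mulr1.
by rewrite mulrACA wsign_sqr mulr1.
Qed.

Lemma wsign_cons i w : wsign F (i :: w) = (-1) ^+ count (below i) w * wsign F w.
Proof. by rewrite /wsign inversions_cons exprD. Qed.

Lemma count_mem_word_of d (a : Mon n d) i : count_mem i (word_of a) = a i.
Proof.
rewrite /word_of count_flatten -map_comp sumnE big_map big_enum /=.
rewrite (bigD1 i) //= count_nseq /= eqxx mul1n big1 ?addn0 // => k /negPf ne_ki.
by rewrite count_nseq /= ne_ki.
Qed.

Lemma size_word_of d (a : Mon n d) : size (word_of a) = deg a.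
Proof.
rewrite /word_of size_flatten /shape -map_comp sumnE big_map big_enum /=.
by apply: eq_bigr => i _; rewrite size_nseq.
Qed.

Lemma wsign_word_of d (a : Mon n d) : wsign F (word_of a) = 1.
Proof.
rewrite /wsign; suff -> : inversions (word_of a) = 0%N by [].
rewrite /word_of.
have : sorted ltn (map (@nat_of_ord _) (enum 'Z_n)).
  by rewrite val_enum_ord iota_ltn_sorted.
elim: (enum _) => [|i s IH] /=; first by rewrite /inversions !big_ord0.
rewrite (path_sortedE ltn_trans) => /andP[/allP lt_i /IH{}IH].
rewrite inversions_cat IH addn0 big1_seq ?addn0 => [|k].
  elim: {IH lt_i}(a i : nat) => [|l IHl] /=; first by rewrite /inversions big_ord0.
  by rewrite inversions_cons IHl addn0 count_nseq /below /= ltnn.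
rewrite mem_nseq => /andP[_ /andP[_ /eqP->]].
apply/eqP; rewrite -leqn0 leqNgt -has_count; apply/hasP => -[l].
case/flattenP=> t /mapP[m m_s ->]; rewrite mem_nseq => /andP[_ /eqP->].
rewrite /below ltnNge ltnW // lt_i //.
by apply: map_f.
Qed.

(** These are the words whose exponents [mon_of] records faithfully; beyond them [inord] falls back
    to its default. *)
Definition bounded d w := [forall i : 'Z_n, count_mem i w <= d]%N.

Lemma boundedP d w : reflect (forall i, count_mem i w <= d)%N (bounded d w).
Proof. exact: forallP. Qed.

Lemma size_bounded d w : (size w <= d)%N -> bounded d w.
Proof.
by move=> le_wd; apply/boundedP=> i; apply: leq_trans (count_size _ _) le_wd.
Qed.

Lemma bounded_perm d u w : perm_eq u w -> bounded d u = bounded d w.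
Proof. by move/permP=> eq_uw; apply: eq_forallb => i; rewrite eq_uw. Qed.

Lemma bounded_word_of d (a : Mon n d) : bounded d (word_of a).
Proof. by apply/boundedP=> i; rewrite count_mem_word_of -ltnS. Qed.

Lemma bounded_catr d u w : bounded d (u ++ w) -> bounded d w.
Proof.
move/boundedP=> le_d; apply/boundedP=> i; apply: leq_trans (le_d i).
by rewrite count_cat leq_addl.
Qed.

Lemma bounded_map_add d f w : bounded d (map (fun i => i + f) w) = bounded d w.
Proof.
apply/boundedP/boundedP => le_d i.
  have := le_d (i + f); rewrite count_map (eq_count (a2 := pred1 i)) // => k /=.
  by rewrite (inj_eq (addIr f)).
rewrite count_map (eq_count (a2 := pred1 (i - f))) ?le_d // => k /=.
by rewrite [RHS]eq_sym subr_eq eq_sym.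
Qed.

Lemma mon_ofE d w i : bounded d w -> mon_of d w i = count_mem i w :> nat.
Proof. by move/boundedP=> le_d; rewrite ffunE inordK // ltnS. Qed.

Lemma perm_word_of_mon d w : bounded d w -> perm_eq (word_of (mon_of d w)) w.
Proof.
by move=> b_w; apply/allP=> i _ /=; rewrite count_mem_word_of mon_ofE.
Qed.

Lemma mon_of_perm d u w : perm_eq u w -> mon_of d u = mon_of d w.
Proof. by move/permP=> eq_uw; apply/ffunP=> i; rewrite !ffunE eq_uw. Qed.

Lemma word_ofK d (a : Mon n d) : mon_of d (word_of a) = a.
Proof.
apply/ffunP=> i; apply: val_inj.
by rewrite /= mon_ofE ?bounded_word_of ?count_mem_word_of.
Qed.

Lemma deg_mon_of d w : bounded d w -> deg (mon_of d w) = size w.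
Proof. by move=> b_w; rewrite -size_word_of; apply/perm_size/perm_word_of_mon. Qed.

End Words.

(** * Signs under the cyclic shift of the variables *)

Section ShiftSign.
Variables (F : fieldType) (n : nat).
Implicit Types (i k f : 'Z_n) (u w : seq 'Z_n).

Lemma belowN i k : i != k -> below i k = ~~ below k i.
Proof.
by move=> ne_ik; rewrite /below -leqNgt ltn_neqAle eq_sym (inj_eq val_inj) ne_ik.
Qed.

Lemma wsign_swap i k w : i != k -> wsign F (i :: k :: w) = - wsign F (k :: i :: w).
Proof.
move=> ne_ik; rewrite !wsign_cons /= !exprD (belowN ne_ik) signrN !mulNr.
by congr (- _); rewrite -!mulrA; congr (_ * _); rewrite mulrCA.
Qed.

Definition shift f w : seq 'Z_n := map (fun i => i + f) w.

(** The sign relating the image under [sigma^f] of the ordered monomial of [w] to the ordered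
    monomial of the shifted word. *)
Definition shift_sign f w : F := wsign F (shift f w) * wsign F w.

(* Symmetric in [i] and [k], so [shift_sign] depends only on the letters of a word
   and not on their order. *)
Definition exchanged f i k := below i k (+) below (i + f) (k + f).

Lemma exchangedC f i k : exchanged f i k = exchanged f k i.
Proof.
rewrite /exchanged; have [-> //|ne_ik] := eqVneq i k.
have ne_ikf : i + f != k + f by rewrite (inj_eq (addIr f)).
by rewrite (belowN ne_ik) (belowN ne_ikf) addNb addbN negbK.
Qed.

(** A pair of letters from the two blocks contributes a sign exactly when the shift reverses its
    order. *)
Lemma shift_sign_cat f u w :
  shift_sign f (u ++ w) =
  shift_sign f u * shift_sign f w *
  (-1) ^+ (\sum_(i <- u) \sum_(k <- w) exchanged f i k)%N.
Proof.
rewrite /shift_sign [shift f (_ ++ _)]map_cat !wsign_cat -!/(shift f _).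
have -> : (-1) ^+ (\sum_(i <- u) \sum_(k <- w) exchanged f i k)%N =
  (-1) ^+ (\sum_(i <- shift f u) count (below i) (shift f w))%N
  * (-1) ^+ (\sum_(i <- u) count (below i) w)%N :> F.
  rewrite -exprD big_map -big_split /= -[LHS]signr_odd -[RHS]signr_odd.
  congr (_ ^+ nat_of_bool _); elim: u => [|i u IH]; first by rewrite !big_nil.
  rewrite !big_cons !oddD {}IH; congr (_ (+) _).
  elim: w => [|k w IH] /=; first by rewrite big_nil.
  rewrite big_cons oddD IH !oddD !oddb /exchanged.
  by do 2!case: (odd _); do 2!case: (below _ _).
by rewrite [LHS]mulrACA; congr (_ * _); rewrite mulrACA.
Qed.

(** This makes [sigma^f] well defined on words. Swapping two blocks suffices, and there the cross
    terms agree because [exchanged] is symmetric. *)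
Lemma shift_sign_perm f u w : perm_eq u w -> shift_sign f u = shift_sign f w.
Proof.
pose P w := shift_sign f u = shift_sign f w.
move=> eq_uw; apply: (@catCA_perm_ind _ P _ u) => // s1 s2 s3; rewrite /P => ->.
rewrite !catA !(shift_sign_cat f (_ ++ _)) !(shift_sign_cat f _ s2).
rewrite (shift_sign_cat f s2 s1).
rewrite !big_cat /= [in RHS]addnC [shift_sign f s2 * _]mulrC.
congr (_ * _ ^+ _ * _ * _); rewrite exchange_big.
by apply: eq_bigr => i _; apply: eq_bigr => k _; rewrite exchangedC.
Qed.

End ShiftSign.

(** * Left multiplication by variables and group elements on the truncation *)

Section Operators.
Variables (F : fieldType) (n d : nat).
Implicit Types (i k f g : 'Z_n) (u w : seq 'Z_n) (p : Mon n d * 'Z_n).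
Local Notation Sp := (Sp F n d).

Lemma Sp_basis (v : Sp) : v = \sum_p v p *: basis_vec F p.
Proof.
apply/ffunP=> q; rewrite sum_ffunE (bigD1 q) //= big1 ?addr0 => [|p ne_pq].
  by rewrite !ffunE eqxx; apply/esym/mulr1.
by rewrite !ffunE eq_sym (negPf ne_pq) scaler0.
Qed.

Lemma eq_lfun_basis (T : vectType F) (A B : 'Hom(Sp, T)) :
  (forall p, A (basis_vec F p) = B (basis_vec F p)) -> A = B.
Proof.
move=> eqAB; apply/lfunP=> v; rewrite (Sp_basis v) !linear_sum.
by apply: eq_bigr => p _; rewrite !linearZ /= eqAB.
Qed.

Definition extend_fun (phi : Mon n d * 'Z_n -> Sp) (v : Sp) : Sp :=
  \sum_p v p *: phi p.

Lemma extend_fun_linear phi : linear (extend_fun phi).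
Proof.
move=> a u v; rewrite scaler_sumr -big_split /=; apply: eq_bigr => p _.
by rewrite !ffunE scalerDl scalerA.
Qed.

HB.instance Definition _ phi :=
  GRing.isLinear.Build F Sp Sp _ (extend_fun phi) (extend_fun_linear phi).

Definition extend phi : 'End(Sp) := linfun (extend_fun phi).

Lemma extendE phi p : extend phi (basis_vec F p) = phi p.
Proof.
rewrite lfunE /= /extend_fun (bigD1 p) //= big1 ?addr0 => [|q ne_qp].
  by rewrite ffunE eqxx scale1r.
by rewrite ffunE (negPf ne_qp) scale0r.
Qed.

(* The image of the word [w] times [sigma ^ g] in the truncation of [A # C_n] by
   all [x_i ^ d.+1]. *)
Definition wvec w g : Sp :=
  if bounded d w then wsign F w *: basis_vec F (mon_of d w, g) else 0.

Lemma basis_wvec p : basis_vec F p = wvec (word_of p.1) p.2.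
Proof.
by case: p => a g; rewrite /wvec bounded_word_of wsign_word_of scale1r word_ofK.
Qed.

Lemma wvec_perm u w g : perm_eq u w ->
  wvec w g = (wsign F u * wsign F w) *: wvec u g.
Proof.
move=> eq_uw; rewrite /wvec (bounded_perm d eq_uw) (mon_of_perm d eq_uw).
case: ifP => _; last by rewrite scaler0.
by rewrite scalerA mulrAC wsign_sqr mul1r.
Qed.

Lemma eq_lfun_wvec (T : vectType F) (A B : 'Hom(Sp, T)) :
  (forall w g, A (wvec w g) = B (wvec w g)) -> A =1 B.
Proof.
by move=> eqAB v; rewrite (@eq_lfun_basis T A B) // => p; rewrite basis_wvec.
Qed.

Definition X i : 'End(Sp) := extend (fun p => wvec (i :: word_of p.1) p.2).

(** Left multiplication by [sigma^f]: it shifts the monomial and translates the group component. *)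
Definition G f : 'End(Sp) :=
  extend (fun p => wvec (shift f (word_of p.1)) (f + p.2)).

(** The inversions created by a leading [i] depend only on the letters of [w], so the definition on
    ordered words extends to all words. *)
Lemma X_wvec i w g : X i (wvec w g) = wvec (i :: w) g.
Proof.
rewrite {1}/wvec; case: ifP => b_w; last first.
  rewrite linear0 /wvec; case: ifP => // /(@bounded_catr _ _ [:: i]).
  by rewrite b_w.
have eq_w := perm_word_of_mon b_w.
rewrite linearZ /= extendE /=.
rewrite [RHS](@wvec_perm (i :: word_of (mon_of d w))) ?perm_cons //.
congr (_ *: _); rewrite !wsign_cons wsign_word_of mulr1 (permP eq_w).
by rewrite mulrA -expr2 sqrr_sign mul1r.
Qed.

Lemma G_wvec f w g : G f (wvec w g) = wvec (shift f w) (f + g).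
Proof.
rewrite {1}/wvec; case: ifP => b_w; last first.
  by rewrite linear0 /wvec bounded_map_add b_w.
have eq_w := perm_word_of_mon b_w.
rewrite linearZ /= extendE /=.
rewrite [RHS](@wvec_perm (shift f (word_of (mon_of d w)))) ?perm_map //.
congr (_ *: _); have := shift_sign_perm F f eq_w.
rewrite /shift_sign wsign_word_of mulr1 => ->.
by rewrite mulrAC wsign_sqr mul1r.
Qed.

Definition Xword u : 'End(Sp) := foldr (fun i A => (X i \o A)%VF) \1%VF u.

Lemma Xword_cons i u v : Xword (i :: u) v = X i (Xword u v).
Proof. exact: comp_lfunE. Qed.

Lemma Xword_cat u w v : Xword (u ++ w) v = Xword u (Xword w v).
Proof. by elim: u => [|i u IH]; rewrite ?id_lfunE // cat_cons !Xword_cons IH. Qed.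

Lemma Xword_wvec u w g : Xword u (wvec w g) = wvec (u ++ w) g.
Proof. by elim: u => [|i u IH]; rewrite ?id_lfunE // Xword_cons IH X_wvec. Qed.

Lemma X_anticomm i k v : i != k -> X i (X k v) = - X k (X i v).
Proof.
move=> ne_ik; rewrite -!comp_lfunE -opp_lfunE; apply: eq_lfun_wvec => w g.
rewrite opp_lfunE !comp_lfunE !X_wvec.
rewrite (@wvec_perm (k :: i :: w)) => [|]; last by rewrite (perm_catCA [:: k] [:: i]).
by rewrite (wsign_swap _ _ ne_ik) mulrN wsign_sqr scaleN1r.
Qed.

Lemma G_X f i v : G f (X i v) = X (i + f) (G f v).
Proof.
rewrite -!comp_lfunE; apply: eq_lfun_wvec => w g.
by rewrite !comp_lfunE !(X_wvec, G_wvec).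
Qed.

Lemma G_G f g v : G f (G g v) = G (f + g) v.
Proof.
rewrite -!comp_lfunE; apply: eq_lfun_wvec => w h.
rewrite !comp_lfunE !G_wvec -addrA; congr wvec.
by rewrite /shift -map_comp; apply: eq_map => i /=; rewrite -addrA [g + f]addrC.
Qed.

Lemma G0 v : G 0 v = v.
Proof.
rewrite -[RHS]id_lfunE; apply: eq_lfun_wvec => w g.
by rewrite id_lfunE G_wvec add0r /shift map_id_in // => i _; rewrite addr0.
Qed.

End Operators.

(** * Characters of the cyclic group *)

Section Characters.
Variables (F : fieldType) (n : nat) (z : F).
Hypotheses (n_gt1 : (1 < n)%N) (z_prim : n.-primitive_root z).
Implicit Types i j k f g s : 'Z_n.

Definition chi i k : F := z ^+ (i * k)%N.

Lemma chiC i k : chi i k = chi k i.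
Proof. by rewrite /chi mulnC. Qed.

Lemma chiDl i j k : chi (i + j) k = chi i k * chi j k.
Proof.
rewrite /chi; have -> : i + j = ((i + j) %% n)%N :> nat.
  by rewrite /= [X in (_ %% X)%N]Zp_cast.
rewrite -exprD -mulnDl [in LHS]mulnC [in RHS]mulnC !exprM.
by rewrite expr_mod // exprAC (prim_expr_order z_prim) expr1n.
Qed.

Lemma chi0l k : chi 0 k = 1.
Proof. by rewrite /chi mul0n. Qed.

Lemma chiDr i j k : chi k (i + j) = chi k i * chi k j.
Proof. by rewrite !(chiC k) chiDl. Qed.

Lemma chi0r k : chi k 0 = 1.
Proof. by rewrite chiC chi0l. Qed.

(** Orthogonality: translating the summation index multiplies the sum by [chi 1 k], which is not 1
    for nonzero [k] since [z] is primitive. *)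
Lemma chi_sum k : \sum_s chi s k = if k == 0 then n%:R else 0.
Proof.
case: eqP => [->|/eqP nz_k].
  rewrite (eq_bigr (fun=> 1)) => [|s _]; last by rewrite chi0r.
  by rewrite sumr_const card_ord Zp_cast.
apply/eqP; have : (chi 1 k - 1) * (\sum_s chi s k) == 0.
  rewrite mulrBl mul1r subr_eq0 mulr_sumr; apply/eqP.
  rewrite [RHS](reindex_inj (addrI 1)); apply: eq_bigr => s _.
  by rewrite chiDl.
rewrite mulf_eq0 => /orP[|//]; rewrite subr_eq0 /chi.
have -> : (1 : 'Z_n) = 1%N :> nat by rewrite /= modn_small.
rewrite mul1n -(prim_order_dvd z_prim) => /dvdn_leq le_nk.
have := ltn_ord k; rewrite [X in (_ < X)%N]Zp_cast // ltnNge le_nk //.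
by rewrite lt0n.
Qed.

End Characters.

(** * The walk module given by the eigenvariables and the ideal of [e_0] *)

Section Walk.
Variables (F : fieldType) (n d : nat) (z : F).
Hypotheses (F_char0 : [pchar F] =i pred0).
Hypotheses (n_gt1 : (1 < n)%N) (z_prim : n.-primitive_root z).
Implicit Types (i k f g s : 'Z_n) (u w : seq 'Z_n) (v x : Sp F n d).
Local Notation Sp := (Sp F n d).
Local Notation chi := (chi z).
Local Notation X := (@X F n d).
Local Notation G := (@G F n d).
Local Notation Xword := (@Xword F n d).

Definition eigenvar g : 'End(Sp) := \sum_i chi g i *: X i.

Definition central_var g : 'End(Sp) := \sum_i chi g i *: (X i \o X i)%VF.

(** The sign of [f] is chosen so that [eigenvar g] raises the state by [g]. *)
Definition in_state s v : Prop := forall f, G f v = chi s (- f) *: v.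

Definition average : 'End(Sp) := n%:R^-1 *: \sum_f G f.

(* [average] is left multiplication by [e_0]. *)
Definition e0_ideal v : Prop :=
  forall W : {vspace Sp}, (forall u x, Xword u (average x) \in W) -> v \in W.

Lemma eigenvarE g v : eigenvar g v = \sum_i chi g i *: X i v.
Proof. by rewrite sum_lfunE; apply: eq_bigr => i _; rewrite scale_lfunE. Qed.

Lemma central_varE g v : central_var g v = \sum_i chi g i *: X i (X i v).
Proof.
by rewrite sum_lfunE; apply: eq_bigr => i _; rewrite scale_lfunE comp_lfunE.
Qed.

Lemma char0_natr_neq0 m : (0 < m)%N -> m%:R != 0 :> F.
Proof. by move/(pcharf0P F).1: F_char0 => ->; rewrite lt0n. Qed.

Lemma eigenvar_comp g h v :
  eigenvar g (eigenvar h v) = \sum_i \sum_k (chi g i * chi h k) *: X i (X k v).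
Proof.
rewrite !eigenvarE; apply: eq_bigr => i _; rewrite linear_sum scaler_sumr.
by apply: eq_bigr => k _; rewrite linearZ /= scalerA.
Qed.

(** Terms with distinct indices cancel by anticommutation; the squares remain, each twice. *)
Lemma eigenvar_anticomm g h v :
  eigenvar g (eigenvar h v) + eigenvar h (eigenvar g v) =
  central_var (g + h) v *+ 2.
Proof.
rewrite !eigenvar_comp [X in _ + X]exchange_big -big_split /=.
rewrite central_varE -sumrMnl; apply: eq_bigr => i _.
rewrite -big_split (bigD1 i) //= big1 ?addr0 => [|k ne_ki].
  by rewrite [chi h i * _]mulrC -chiDl // mulr2n.
by rewrite (X_anticomm _ ne_ki) [chi h k * _]mulrC scalerN subrr.
Qed.

Lemma Sp_half v : v = 2^-1 *: (v *+ 2).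
Proof. by rewrite -scaler_nat scalerA mulVf ?scale1r ?char0_natr_neq0. Qed.

Lemma eigenvar_sqr g v : eigenvar g (eigenvar g v) = central_var (g + g) v.
Proof. by rewrite [LHS]Sp_half (mulr2n (eigenvar _ _)) eigenvar_anticomm -Sp_half. Qed.

Lemma X_sqr_central i k v : X i (X i (X k v)) = X k (X i (X i v)).
Proof.
have [-> //|ne_ik] := eqVneq i k.
by rewrite (X_anticomm v ne_ik) linearN /= (X_anticomm (X i v) ne_ik) opprK.
Qed.

Lemma central_var_X j k v : central_var j (X k v) = X k (central_var j v).
Proof.
rewrite !central_varE linear_sum; apply: eq_bigr => i _.
by rewrite X_sqr_central linearZ.
Qed.

Lemma central_var_eigenvar j g v :
  central_var j (eigenvar g v) = eigenvar g (central_var j v).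
Proof.
rewrite !(eigenvarE g) linear_sum; apply: eq_bigr => k _.
by rewrite linearZ /= central_var_X.
Qed.

Lemma chi_shift f g (A : 'Z_n -> Sp) :
  \sum_i chi g i *: A (i + f) = chi g (- f) *: \sum_i chi g i *: A i.
Proof.
rewrite scaler_sumr (reindex_inj (addIr (- f))); apply: eq_bigr => i _.
by rewrite subrK chiDr // scalerA mulrC.
Qed.

Lemma eigenvar_state s g v : in_state s v -> in_state (s + g) (eigenvar g v).
Proof.
move=> Uv f; rewrite eigenvarE linear_sum /=.
rewrite (eq_bigr (fun i => chi s (- f) *: (chi g i *: X (i + f) v))).
  by rewrite -scaler_sumr (chi_shift f g (fun i => X i v)) scalerA chiDl.
by move=> i _; rewrite linearZ /= G_X Uv linearZ /= !scalerA mulrC.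
Qed.

Lemma central_var_state s g v : in_state s v -> in_state (s + g) (central_var g v).
Proof.
move=> Uv f; rewrite central_varE linear_sum /=.
rewrite (eq_bigr (fun i => chi s (- f) *: (chi g i *: X (i + f) (X (i + f) v)))).
  rewrite -scaler_sumr (chi_shift f g (fun i => X i (X i v))) scalerA.
  by rewrite chiDl.
move=> i _; rewrite linearZ /= 2!G_X Uv linearZ /= linearZ /=.
by rewrite scalerA mulrC -scalerA.
Qed.

Lemma e0_ideal_add x v : e0_ideal x -> e0_ideal v -> e0_ideal (x + v).
Proof. by move=> Kx Kv W KW; rewrite memvD ?Kx ?Kv. Qed.

Lemma e0_ideal_scale a v : e0_ideal v -> e0_ideal (a *: v).
Proof. by move=> Kv W KW; rewrite memvZ ?Kv. Qed.

Lemma e0_ideal_X i v : e0_ideal v -> e0_ideal (X i v).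
Proof.
move=> Kv W KW; rewrite memv_preim; apply: Kv => u x.
by rewrite -memv_preim -Xword_cons.
Qed.

Lemma e0_ideal_sum (I : Type) (r : seq I) (P : pred I) (A : I -> Sp) :
  (forall j, P j -> e0_ideal (A j)) -> e0_ideal (\sum_(j <- r | P j) A j).
Proof. by move=> KA W KW; apply: memv_suml => j /KA; apply. Qed.

(** A vector fixed by all shifts equals its own [average], a generator with empty word. *)
Lemma state0_e0_ideal v : in_state 0 v -> e0_ideal v.
Proof.
move=> Uv W KW; suff -> : v = average v by have := KW [::] v; rewrite id_lfunE.
rewrite scale_lfunE sum_lfunE (eq_bigr (fun=> v)) => [|f _]; last first.
  by rewrite Uv chi0l scale1r.
rewrite sumr_const (_ : #|_| = n); last by rewrite card_ord Zp_cast.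
by rewrite -scaler_nat scalerA mulVf ?scale1r // char0_natr_neq0 // ltnW.
Qed.

Lemma e0_walk_module :
  walk_module eigenvar central_var in_state e0_ideal.
Proof.
split; [exact: eigenvar_anticomm | exact: eigenvar_sqr |
  exact: central_var_eigenvar | exact: eigenvar_state |
  exact: central_var_state | exact: state0_e0_ideal | exact: e0_ideal_add | |].
- move=> g v Kv; rewrite eigenvarE; apply: e0_ideal_sum => i _.
  by apply/e0_ideal_scale/e0_ideal_X.
by move=> v Kv; rewrite [v]Sp_half; apply: e0_ideal_scale.
Qed.

(** The components are the isotypic projections of [v]; their sum is [v] by orthogonality. *)
Lemma state_decomposition v :
  exists2 A : 'Z_n -> Sp, forall s, in_state s (A s) & v = \sum_s A s.
Proof.
exists (fun s => n%:R^-1 *: \sum_f chi s f *: G f v).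
  move=> s f; rewrite linearZ /= scalerA mulrC -scalerA; congr (_ *: _).
  rewrite linear_sum -chi_shift; apply: eq_bigr => k _.
  by rewrite linearZ /= G_G addrC.
rewrite -scaler_sumr exchange_big /=.
under eq_bigr => f _ do rewrite -scaler_suml chi_sum //.
rewrite (bigD1 0) //= big1 => [|f /negPf->]; last by rewrite scale0r.
by rewrite addr0 G0 scalerA mulVf ?scale1r // char0_natr_neq0 // ltnW.
Qed.

(** Fourier inversion of the definition of [central_var]. *)
Lemma X_sqr_central_var i v :
  X i (X i v) = n%:R^-1 *: \sum_j chi j (- i) *: central_var j v.
Proof.
under eq_bigr => j _ do rewrite central_varE scaler_sumr.
rewrite exchange_big /=.
rewrite (eq_bigr (fun k => (if k == i then n%:R else 0) *: X k (X k v))).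
  rewrite (bigD1 i) //= big1 => [|k /negPf->]; last by rewrite scale0r.
  by rewrite eqxx addr0 scalerA mulVf ?scale1r // char0_natr_neq0 // ltnW.
move=> k _; rewrite -subr_eq0 -(chi_sum n_gt1 z_prim) scaler_suml.
apply: eq_bigr => j _.
by rewrite scalerA -chiDr // addrC.
Qed.

End Walk.

(** * A spanning set of the quotient in degree [d] *)

Section Quotient.
Variables (F : fieldType) (n d : nat) (z : F).
Hypotheses (F_char0 : [pchar F] =i pred0).
Hypotheses (n_gt1 : (1 < n)%N) (z_prim : n.-primitive_root z).
Implicit Types (i j k f g : 'Z_n) (u w l : seq 'Z_n) (v : Sp F n d).
Local Notation Sp := (Sp F n d).
Local Notation X := (@X F n d).
Local Notation Xword := (@Xword F n d).
Local Notation wvec := (@wvec F n d).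
Local Notation G := (@G F n d).
Local Notation c := (@central_var F n d z).
Local Notation e0_ideal := (@e0_ideal F n d).
Local Notation J := (@ideal_e0 F n d).

(** The truncation contains monomials of many degrees; this projects onto degree [d], where
    [ideal_e0] lives. *)
Definition top : 'End(Sp) :=
  extend (fun p => if deg p.1 == d then basis_vec F p else 0).

Lemma top_wvec w g : top (wvec w g) = if size w == d then wvec w g else 0.
Proof.
rewrite /wvec; case: ifP => b_w; last by rewrite linear0 if_same.
by rewrite linearZ /= extendE deg_mon_of //; case: ifP => // _; rewrite scaler0.
Qed.

(** On a spanning family, a product [u e_0 x^b] is killed by [top] unless its total degree is [d];
    then it is [gen_vec] up to the sign that orders [u]. *)
Lemma top_e0_ideal v : e0_ideal v -> top v \in J.
Proof.
move=> Kv; rewrite memv_preim; apply: Kv => u x; rewrite -memv_preim.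
rewrite (Sp_basis x) !linear_sum; apply: memv_suml => -[b h] _.
rewrite !linearZ /= memvZ // basis_wvec /=.
have -> y : top (Xword u (average F n d y)) =
    n%:R^-1 *: \sum_f top (Xword u (G f y)).
  by rewrite scale_lfunE sum_lfunE !linearZ /= !linear_sum.
have [le_ud|ne_du] := boolP (size u + deg b == d)%N; last first.
  rewrite big1 ?scaler0 ?mem0v // => f _; rewrite G_wvec Xword_wvec top_wvec.
  by rewrite size_cat size_map size_word_of (negPf ne_du).
have b_u : bounded d u by apply: size_bounded; rewrite -(eqP le_ud) leq_addr.
pose q := ((mon_of d u, 0 : 'Z_n), (b, h)).
suff -> : n%:R^-1 *: (\sum_f top (Xword u (G f (wvec (word_of b) h)))) =
    wsign F u *: gen_vec F q.
  by apply/memvZ/memv_span/imageP; exists q.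
rewrite /gen_vec /q deg_mon_of // le_ud scalerA mulrC -scalerA; congr (_ *: _).
rewrite scaler_sumr; apply: eq_bigr => f _; rewrite add0r G_wvec Xword_wvec top_wvec.
rewrite size_cat size_map size_word_of le_ud -/(shift f _).
set y := shift f _.
have eq_u : perm_eq (word_of (mon_of d u) ++ y) (u ++ y).
  by rewrite perm_cat2r perm_word_of_mon.
rewrite (wvec_perm _ _ _ eq_u) wsign_cat_perm ?perm_word_of_mon // wsign_word_of mul1r.
congr (_ *: _); rewrite /wvec size_bounded // size_cat size_word_of deg_mon_of //.
by rewrite size_map size_word_of (eqP le_ud).
Qed.

Definition cword l : 'End(Sp) := foldr (fun j A => (c j \o A)%VF) \1%VF l.

Lemma cword_cons j l v : cword (j :: l) v = c j (cword l v).
Proof. exact: comp_lfunE. Qed.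

Lemma central_varC j k v : c j (c k v) = c k (c j v).
Proof.
rewrite ![c k _]central_varE linear_sum; apply: eq_bigr => i _.
by rewrite linearZ /= !central_var_X.
Qed.

Lemma cword_central j l v : cword l (c j v) = c j (cword l v).
Proof.
elim: l => [|k l IH]; first by rewrite !id_lfunE.
by rewrite !cword_cons IH central_varC.
Qed.

Lemma cword_cat u w v : cword (u ++ w) v = cword u (cword w v).
Proof. by elim: u => [|i u IH]; rewrite ?id_lfunE // cat_cons !cword_cons IH. Qed.

Lemma cwordC u w v : cword u (cword w v) = cword w (cword u v).
Proof.
elim: u => [|j u IH]; first by rewrite !id_lfunE.
by rewrite !cword_cons IH cword_central.
Qed.

Lemma cword_perm u w v : perm_eq u w -> cword u v = cword w v.
Proof.
pose P w := cword u v = cword w v.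
move=> eq_uw; apply: (@catCA_perm_ind _ P _ u) => // s1 s2 s3; rewrite /P => ->.
by rewrite !cword_cat cwordC.
Qed.

Lemma cword_nilpotent M j l v : (forall x, e0_ideal (iter M (c j) x)) ->
  (M <= count_mem j l)%N -> e0_ideal (cword l v).
Proof.
have W := e0_walk_module d F_char0 n_gt1 z_prim.
(* Generalization for the induction: [m] counts the factors [c j] already moved onto the vector. *)
move=> nil_j leM; suff Kl m : (M <= m + count_mem j l)%N ->
    e0_ideal (cword l (iter m (c j) v)) by apply: (Kl 0).
elim: l m {leM} => [|k l IH] m /=.
  by rewrite addn0 id_lfunE => leM; apply: (walk_iter_leq W leM).
rewrite cword_cons; have [->|ne_kj] := eqVneq k j.
  by rewrite addnA addn1 -cword_central; apply: (IH m.+1).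
by move/IH; apply: (walk_stable_central W).
Qed.

Definition doubled l : seq 'Z_n := flatten [seq [:: i; i] | i <- l].

(** Each square of a variable is expanded in the [c j]; the induction pulls [T] back along that
    square. *)
Lemma Xword_doubled l v (T : {vspace Sp}) :
  (forall l', size l' = size l -> cword l' v \in T) -> Xword (doubled l) v \in T.
Proof.
elim: l T => [|i l IH] T Tl; first exact: (Tl [::]).
rewrite -[doubled _]/(i :: i :: doubled l) !Xword_cons 2!memv_preim.
apply: IH => l' sz_l'.
rewrite -2!memv_preim (X_sqr_central_var F_char0 n_gt1 z_prim).
apply/memvZ/memv_suml => j _; rewrite -cword_cons.
by apply/memvZ/Tl; rewrite /= sz_l'.
Qed.

(** Up to sign a monomial is a product of squares and a squarefree part. The squares become words in
    the [c j], and a word with at least [M] factors [c j] for some [j] in [phi] falls into the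
    ideal. *)
Lemma basis_span (phi : {set 'Z_n}) M (T : {vspace Sp}) a g :
  (forall j x, j \in phi -> e0_ideal (iter M (c j) x)) ->
  (forall l (S : {set 'Z_n}) h, (size l).*2 + #|S| = d ->
     (forall j, j \in phi -> count_mem j l < M) ->
     top (cword l (Xword (enum S) (wvec [::] h))) \in T)%N ->
  (J <= T)%VS -> deg a = d -> basis_vec F (a, g) \in T.
Proof.
move=> nil_phi Tgood JT deg_a.
(* Each exponent is split into twice its half and its parity. *)
pose half : Mon n d := [ffun i => inord (a i)./2].
pose S := [set i | odd (a i)]; pose w := doubled (word_of half) ++ enum S.
have half_i i : half i = (a i)./2 :> nat.
  by rewrite ffunE inordK //; have := ltn_ord (a i); lia.
have eq_w : perm_eq w (word_of a).
  apply/allP=> i _ /=; rewrite count_cat count_mem_word_of.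
  have -> : count_mem i (doubled (word_of half)) = (a i)./2.*2.
    rewrite -half_i -count_mem_word_of /doubled; elim: (word_of _) => //= k l ->.
    by rewrite doubleD addnA; case: (k == i).
  by rewrite count_uniq_mem ?enum_uniq // mem_enum inE addnC odd_double_half.
have sz_w : ((deg half).*2 + #|S|)%N = d.
  rewrite -[RHS]deg_a -(size_word_of a) -(perm_size eq_w) size_cat -cardE.
  congr addn; rewrite -size_word_of /doubled.
  by elim: (word_of _) => //= k l <-; rewrite doubleS.
have -> : basis_vec F (a, g) = top (basis_vec F (a, g)).
  by rewrite basis_wvec top_wvec size_word_of deg_a eqxx.
rewrite basis_wvec (wvec_perm _ _ _ eq_w) /= linearZ memvZ //.
rewrite -[w]cats0 -Xword_wvec Xword_cat memv_preim.
apply: Xword_doubled => l sz_l; rewrite -memv_preim.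
have [/forall_inP good_l|] := boolP [forall j in phi, count_mem j l < M]%N.
  by apply: Tgood => //; rewrite sz_l size_word_of.
rewrite negb_forall_in => /exists_inP[j phi_j]; rewrite -leqNgt => leM.
apply/(subvP JT)/top_e0_ideal; apply: cword_nilpotent leM => x.
exact: nil_phi.
Qed.

Lemma dim_basis_span (A : {set Mon n d * 'Z_n}) :
  \dim <<[seq basis_vec F p | p in A]>> = #|A|.
Proof.
have free_all : free [seq basis_vec F p | p <- enum {: Mon n d * 'Z_n}].
  apply: (@basis_free _ _ fullv); rewrite basisEdim; apply/andP; split.
    apply/subvP=> v _; rewrite (Sp_basis v); apply: memv_suml => p _.
    by apply/memvZ/memv_span/map_f; rewrite mem_enum.
  by rewrite size_map -cardE dimvf /dim /= muln1.
have eqA : enum A = filter (mem A) (enum {: Mon n d * 'Z_n}).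
  by rewrite {1}/enum_mem -enumT.
suff /eqP : free [seq basis_vec F p | p in A] by rewrite size_map -cardE.
pose B := filter (predC (mem A)) (enum {: Mon n d * 'Z_n}).
apply: (@catl_free _ _ (map (@basis_vec F n d) B)).
by rewrite /image_mem eqA -map_cat (perm_free (perm_map _ (permEl (perm_filterC _ _)))).
Qed.

(** A triple records the exponents of the [c j], the squarefree part and the group element. Using
    [Mon n e] for every [d <= e] places all these degrees in one index set. *)
Lemma dim_quot_le e (phi : {set 'Z_n}) M : (d <= e)%N ->
  (forall j x, j \in phi -> e0_ideal (iter M (c j) x)) ->
  (dim_quot F n d <= #|[set q : Mon n e * {set 'Z_n} * 'Z_n |
     ((deg q.1.1).*2 + #|q.1.2| == d) && [forall j in phi, q.1.1 j < M]]|)%N.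
Proof.
move=> le_de nil_phi; set A := [set q | _].
pose vec (q : Mon n e * {set 'Z_n} * 'Z_n) :=
  top (cword (word_of q.1.1) (Xword (enum q.1.2) (wvec [::] q.2))).
pose T := (J + <<[seq vec q | q in A]>>)%VS.
have le_T : (\dim T <= \dim J + #|A|)%N.
  apply: leq_trans (dimv_add_leqif _ _) _; rewrite leq_add2l.
  by rewrite (leq_trans (dim_span _)) // size_map -cardE.
rewrite /dim_quot leq_subLR; apply: leq_trans le_T.
rewrite -cardsT -cardsX -dim_basis_span dimvS //.
apply/span_subvP => x /imageP[[a g]]; rewrite !inE andbT => /eqP deg_a ->{x}.
apply: (@basis_span phi M) => //; last exact: addvSl.
move=> l S h sz_l good_l; apply: (subvP (addvSr _ _)).
have b_l : bounded e l by apply: size_bounded; lia.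
apply/memv_span/imageP; exists (mon_of e l, S, h).
  rewrite inE /= deg_mon_of // sz_l eqxx; apply/forall_inP=> j /good_l.
  by rewrite mon_ofE.
rewrite /vec /=; congr (top _); apply: cword_perm.
by rewrite perm_sym perm_word_of_mon.
Qed.

End Quotient.

(** * Counting the spanning sets and bounding the growth *)

Lemma card_mon_le n d (phi : {set 'Z_n}) M :
  (#|[set a : Mon n d | [forall j in phi, a j < M]]| <=
   M ^ #|phi| * d.+1 ^ (#|'Z_n| - #|phi|))%N.
Proof.
pose B j := if j \in phi then [pred x : 'I_d.+1 | (x < M)%N] else predT.
have card_lt : (#|[pred x : 'I_d.+1 | (x < M)%N]| <= M)%N.
  rewrite cardE -(size_map val) -[X in (_ <= X)%N](size_iota 0).
  apply: uniq_leq_size => [|x].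
    by rewrite map_inj_uniq ?enum_uniq //; apply: val_inj.
  by case/mapP=> y; rewrite mem_enum mem_iota => lt_yM ->.
rewrite (eq_card (B := family B)) => [|a]; last first.
  rewrite inE; apply/forall_inP/familyP => aM j => [|phi_j].
    by rewrite /B; case: ifP => // /aM.
  by have := aM j; rewrite /B phi_j.
rewrite card_family foldrE big_map big_enum /= (bigID (mem phi)) /=.
rewrite (_ : #|_| - #|phi| = #|[predC phi]|)%N; last by rewrite -(cardC phi) addKn.
rewrite -!prod_nat_const; apply: leq_mul.
  by apply: leq_prod => j phi_j; rewrite /B phi_j.
by apply: leq_prod => j /negPf nphi_j; rewrite /B nphi_j card_ord.
Qed.

(** [X^n - 1] is separable, so it has [n] distinct roots, and among [n] distinct [n]-th roots of
    unity one is primitive. *)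
Lemma closed_field_prim_root (F : closedFieldType) n : n%:R != 0 :> F ->
  exists z : F, n.-primitive_root z.
Proof.
move=> nz_n; have n_gt0 : (0 < n)%N by case: n nz_n => //; rewrite eqxx.
have [r Dr] := closed_field_poly_normal ('X^n - 1 : {poly F}).
rewrite lead_coefXnsubC // scale1r in Dr.
have sz_r : size r = n.
  by apply: succn_inj; rewrite -(size_XnsubC (1 : F) n_gt0) Dr size_prod_XsubC.
have uniq_r : uniq r.
  by rewrite -separable_prod_XsubC -Dr separable_Xn_sub_1.
have: has n.-primitive_root r.
  apply: has_prim_root => //; last by rewrite sz_r.
  by apply/allP=> x; rewrite -root_prod_XsubC -Dr.
by case/hasP=> z _; exists z.
Qed.

Lemma sum_eq_le1 d (m : nat) : (\sum_(D < d.+1) (m == D) <= 1)%N.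
Proof.
rewrite -big_mkcond sum1_card; apply/card_le1_eqP => i j.
by rewrite !unfold_in => /eqP Di /eqP Dj; apply: val_inj; rewrite /= -Di.
Qed.

Lemma hilb_quot_le (F : closedFieldType) n : [pchar F] =i pred0 -> (1 < n)%N ->
  forall phi : {set 'Z_n}, (forall j, j \in phi -> exists w, gcdn j n = (2 ^ w)%N) ->
  exists C, forall d, (hilb_quot F n d <= C * d.+1 ^ (#|'Z_n| - #|phi|))%N.
Proof.
move=> F_char0 n_gt1 phi phi_pow2.
have n_neq0 := char0_natr_neq0 F_char0 (ltnW n_gt1).
have [z z_prim] := closed_field_prim_root n_neq0.
have [M nilM] := nilpotent_uniform F n_gt1.
pose card_SZ := #|{: {set 'Z_n} * 'Z_n}|.
exists (M ^ #|phi| * card_SZ)%N => d.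
pose good (q : Mon n d * {set 'Z_n} * 'Z_n) := [forall j in phi, q.1.1 j < M]%N.
pose wt (q : Mon n d * {set 'Z_n} * 'Z_n) := ((deg q.1.1).*2 + #|q.1.2|)%N.
have nil_phi D j (x : Sp F n D) : j \in phi -> e0_ideal (iter M (central_var D z j) x).
  move=> /phi_pow2 pow2_j; have W := e0_walk_module D F_char0 n_gt1 z_prim.
  have [A UA ->] := state_decomposition F_char0 n_gt1 z_prim x.
  (* Nilpotency is known on single states and passes to their sum by additivity. *)
  rewrite (big_morph _ (iterfD (central_var D z j) M) (id1 := 0)).
    by apply: e0_ideal_sum => s _; apply: (nilM _ _ _ _ _ W) (UA s).
  by elim: (M) => //= m ->; rewrite linear0.
apply: leq_trans (_ : \sum_(D < d.+1) \sum_(q | good q) (wt q == D) <= _)%N.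
  apply: leq_sum => D _; have le_Dd : (D <= d)%N by rewrite -ltnS.
  apply: leq_trans (dim_quot_le F_char0 n_gt1 z_prim le_Dd (@nil_phi D)) _.
  rewrite -sum1_card -big_mkcondr /=; apply/eq_leq/eq_bigl => q.
  by rewrite !inE andbC.
(* A triple has only one weight, so it is counted in at most one degree [D]. *)
rewrite exchange_big /=; apply: leq_trans (_ : \sum_(q | good q) 1 <= _)%N.
  by apply: leq_sum => q _; apply: sum_eq_le1.
rewrite sum1_card mulnAC; apply: leq_trans (leq_mul (card_mon_le d phi M) (leqnn _)).
pose assoc (q : Mon n d * {set 'Z_n} * 'Z_n) := (q.1.1, (q.1.2, q.2)).
have assoc_inj : injective assoc by move=> [[a S] g] [[b T] h] [-> -> ->].
rewrite /card_SZ -cardsT -cardsX -(card_imset _ assoc_inj).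
by apply/subset_leq_card/subsetP=> _ /imsetP[q good_q ->]; rewrite !inE andbT.
Qed.

Lemma leq_exp a b e : (a <= b -> a ^ e <= b ^ e)%N.
Proof. by case: e => // e; rewrite leq_exp2r. Qed.

(** For positive [d], [(d + 1)^m <= 2^m d^m]. The [k]-th power of the constant [C * 2^m] is absorbed
    by the one spare factor [d] once [d] exceeds it. *)
Lemma GKdim_le_poly (H : nat -> nat) C m :
  (forall d, H d <= C * d.+1 ^ m)%N -> GKdim_le H m.
Proof.
move=> le_H k _; exists ((C * 2 ^ m) ^ k).+1 => d lt_d.
have d_gt0 : (0 < d)%N by apply: leq_trans lt_d.
have le_Hd : (H d <= C * 2 ^ m * d ^ m)%N.
  apply: leq_trans (le_H d) _; rewrite -mulnA -expnMn leq_mul //.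
  by apply: leq_exp; lia.
apply: leq_trans (leq_exp _ le_Hd) _; rewrite expnMn -expnM addn1 expnS.
by rewrite leq_mul // ltnW.
Qed.

Theorem theorem0p7 (F : closedFieldType) (hF : [pchar F] =i pred0)
    (n : nat) (hn : (2 <= n)%N) :
  GKdim_le (hilb_quot F n) (n - #|phi2 n|).
Proof.
(* With [n] of the form [n.+2], the types ['Z_n] and ['I_n] are convertible, so [phi2] is a set of
   elements of ['Z_n]. *)
case: n hn => [|[|n]] // n_gt1.
have [C le_C] := @hilb_quot_le F n.+2 hF n_gt1 (phi2 n.+2) (fun j => (in_phi2 j).1).
by apply: (@GKdim_le_poly _ C) => d; rewrite -[X in (X - _)%N]card_ord.
Qed.
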